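(* Let $k>1$ be odd. Then $\gamma_{\mathrm{all}}^\infty(\Gamma_k)=\gamma(\Gamma_k)+1$.
   Context: For odd $k\ge 3$, let $G_k=\langle \rho,\tau,a : \rho^k=\tau^2=a^k=e,\ a\in Z(G_k),\ \tau\rho=\rho^{-1}\tau\rangle$, so $G_k\cong D_{2k}\times C_k$ has order $2k^2$ ($D_{2k}$ is the dihedral group of order $2k$, $e$ the identity). For a group $G$ and an inverse-closed subset $S\subseteq G$, $\mathrm{Cay}(G,S)$ is the graph with vertex set $G$ and an edge from $u$ to $us$ for every $u\in G$, $s\in S$. Let $\Gamma_k=\mathrm{Cay}(G_k,S_k)$ where $S_k=\{\tau a^i,\rho^ia^i : 1\le i\le k-1\}\cup\{\rho\tau a,\rho\tau a^{-1}\}$. A vertex $u$ dominates a vertex $w$ if $w=u$ or $w$ is adjacent to $u$. A dominating set is a set $D$ of vertices such that every vertex is dominated by at least one vertex of $D$; $\gamma(\Gamma)$ is the smallest size of a dominating set of $\Gamma$. Guards located at the vertices of a set $D$ (one guard per vertex) can reconfigure to a set $D'$ if there is a bijection $f:D\to D'$ such that for every $d\in D$, either $f(d)=d$ or $f(d)$ is adjacent to $d$. An eternal dominating configuration for $\Gamma$ is a nonempty collection $\mathcal D$ of subsets of $V(\Gamma)$, all of the same cardinality, such that for every $D_i\in\mathcal D$ and every vertex $w\notin D_i$ there is $D_j\in\mathcal D$ with $w\in D_j$ such that guards at $D_i$ can reconfigure to $D_j$. An eternal dominating set is a member of some eternal dominating configuration. The eternal domination number $\gamma_{\mathrm{all}}^\infty(\Gamma)$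 is the smallest cardinality of an eternal dominating set. *)

(* Defs.v *)
From HB Require Import structures.
From mathcomp Require Import all_boot all_order all_algebra all_fingroup.

Set Implicit Arguments.
Unset Strict Implicit.
Unset Printing Implicit Defensive.

Import GroupScope.

Section Domination.

Variables (T : finType) (e : rel T).
Implicit Types (D : {set T}) (DD : {set {set T}}).

Definition dominates (u w : T) : bool := (w == u) || e u w.

Definition dominating D : bool := [forall w, exists u in D, dominates u w].

(* f is a bijection from D onto D'; its values outside D are irrelevant. *)
Definition reconfigures D D' : bool :=
  [exists f : {ffun T -> T},
    [&& f @: D == D', dinjectiveb f D
      & [forall d in D, (f d == d) || e d (f d)]]].

Definition eternal_config DD : bool :=
  [&& DD != set0,
      [forall D in DD, forall D' in DD, #|D| == #|D'|]
    & [forall D in DD, forall w, (w \notin D) ==>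
        [exists D' in DD, (w \in D') && reconfigures D D']]].

Definition eternal_dominating D : bool :=
  [exists DD : {set {set T}}, eternal_config DD && (D \in DD)].

(* By the next two lemmas, the full vertex set is a legitimate starting point
   for the two minimizations that follow. *)
Lemma dominating_setT : dominating [set: T].
Proof.
apply/forallP=> w; apply/existsP; exists w.
by rewrite inE /dominates eqxx.
Qed.

Lemma eternal_dominating_setT : eternal_dominating [set: T].
Proof.
apply/existsP; exists [set [set: T]]; rewrite set11 andbT; apply/and3P; split.
- by apply/set0Pn; exists [set: T]; rewrite set11.
- apply/forall_inP=> D /set1P->.
  by apply/forall_inP=> D' /set1P->.
- by apply/forall_inP=> D /set1P->; apply/forallP=> w; rewrite inE.
Qed.

Definition domination_number : nat :=
  #|[arg min_(D < [set: T] | dominating D) #|D|]|.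

Definition eternal_domination_number : nat :=
  #|[arg min_(D < [set: T] | eternal_dominating D) #|D|]|.

End Domination.

(* u *: S is the left coset { u * s | s \in S }. *)
Definition cay (gT : finGroupType) (S : {set gT}) : rel gT :=
  [rel u w | w \in u *: S].

(* Commuting with all the generators expresses that a is central. *)
Definition Gk_relations (k : nat) (gT : groupType) (rho tau a : gT) : Prop :=
  [/\ [/\ rho ^+ k = 1, tau ^+ 2 = 1 & a ^+ k = 1],
      commute a rho, commute a tau & tau * rho = rho^-1 * tau].

(* gT, with generators rho, tau and a, is the group presented by the above
   relations: the universal property ranges over all groups, finite or not. *)
Definition Gk_presentation (k : nat) (gT : finGroupType) (rho tau a : gT) :
    Prop :=
  [/\ Gk_relations k rho tau a,
      <<[set rho; tau; a]>> = [set: gT]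
    & forall (hT : groupType) (x y z : hT), Gk_relations k x y z ->
        exists f : gT -> hT,
          {morph f : u v / u * v} /\ [/\ f rho = x, f tau = y & f a = z]].

Definition Sk (k : nat) (gT : finGroupType) (rho tau a : gT) : {set gT} :=
  [set tau * a ^+ i | i : 'I_k & 0 < i]
    :|: [set rho ^+ i * a ^+ i | i : 'I_k & 0 < i]
    :|: [set rho * tau * a; rho * tau * a^-1].

Definition Gamma (k : nat) (gT : finGroupType) (rho tau a : gT) : rel gT :=
  cay (Sk k rho tau a).

Lemma cay_sym (gT : finGroupType) (S : {set gT}) :
  S^-1 = S -> symmetric (cay S).
Proof.
move=> SV u w; rewrite /cay /= !mem_lcoset -[in RHS]SV.
by rewrite mem_invg invMg invgK.
Qed.

Lemma Sk_inv (k : nat) (gT : finGroupType) (rho tau a : gT) :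
  Gk_relations k rho tau a -> (Sk k rho tau a)^-1 = Sk k rho tau a.
Proof.
case=> [[rk t2 ak] car cat tr].
have tV : tau^-1 = tau by apply/eqP; rewrite eq_invg_mul -expg2 t2.
have rtV : (rho * tau)^-1 = rho * tau.
  by apply/eqP; rewrite eq_invg_mul -mulgA (mulgA tau) tr -mulgA mulKVg -expg2 t2.
have cart : commute a (rho * tau) by exact: commuteM.
suffices sub s : s \in Sk k rho tau a -> s^-1 \in Sk k rho tau a.
  apply/setP=> s; rewrite mem_invg; apply/idP/idP=> /sub //.
  by rewrite invgK.
have expk (x : gT) (i : 'I_k) : x ^+ k = 1 -> x ^+ (k - i) = x ^- i.
  by move=> xk; apply/esym/eqP; rewrite eq_invg_mul -expgD subnKC ?xk // ltnW.
have subI (i : 'I_k) : 0 < i -> k - i < k.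
  by move=> i0; rewrite ltn_subrL i0 (leq_trans _ (ltn_ord i)).
case/setUP=> [/setUP[]|].
- case/imsetP=> i; rewrite inE => i0 ->; apply/setUP; left; apply/setUP; left.
  apply/imsetP; exists (Ordinal (subI i i0)); first by rewrite inE subn_gt0 /=.
  rewrite /= expk // invMg tV.
  by apply/esym/commuteV/commuteX/commute_sym.
- case/imsetP=> i; rewrite inE => i0 ->; apply/setUP; left; apply/setUP; right.
  apply/imsetP; exists (Ordinal (subI i i0)); first by rewrite inE subn_gt0 /=.
  rewrite /= !expk // -invMg; congr (_^-1).
  by apply/commuteX2/commute_sym.
- case/set2P=> ->; rewrite invMg rtV ?invgK; apply/setUP; right; apply/set2P.
    by right; apply/commute_sym/commuteV/commute_sym.
  by left.
Qed.

(* A concrete group with the presentation: (i, b, j) stands for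
   rho ^+ i * tau ^+ b * a ^+ j. *)
Definition Gk_model (k : nat) : Type := ('Z_k * bool * 'Z_k)%type.

HB.instance Definition _ (k : nat) :=
  Finite.copy (Gk_model k) ('Z_k * bool * 'Z_k)%type.

Section Model.

Variable k : nat.
Implicit Types u v w : Gk_model k.

Let sgn (b : bool) (i : 'Z_k) : 'Z_k := if b then (- i)%R else i.

Definition Gk_mul u v : Gk_model k :=
  ((u.1.1 + sgn u.1.2 v.1.1)%R, u.1.2 (+) v.1.2, (u.2 + v.2)%R).

Definition Gk_one : Gk_model k := (0%R, false, 0%R).

Definition Gk_inv u : Gk_model k :=
  ((- sgn u.1.2 u.1.1)%R, u.1.2, (- u.2)%R).

Lemma Gk_mulA : associative Gk_mul.
Proof.
move=> [[i b] j] [[i' b'] j'] [[i'' b''] j''].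
rewrite /Gk_mul /sgn /= addbA !GRing.addrA; congr (_, _, _).
by case: b b' => [] []; rewrite //= ?GRing.opprD ?GRing.opprK ?GRing.addrA.
Qed.

Lemma Gk_mul1 : left_id Gk_one Gk_mul.
Proof. by case=> [[i b] j]; rewrite /Gk_mul /= !GRing.add0r. Qed.

Lemma Gk_mulV : left_inverse Gk_one Gk_inv Gk_mul.
Proof.
case=> [[i b] j]; rewrite /Gk_mul /Gk_inv /Gk_one /sgn /= addbb.
by case: b; rewrite /= !GRing.addNr ?GRing.opprK ?GRing.addrN.
Qed.

HB.instance Definition _ :=
  Finite_isGroup.Build (Gk_model k) Gk_mulA Gk_mul1 Gk_mulV.

Definition model_rho : Gk_model k := (1%R, false, 0%R).
Definition model_tau : Gk_model k := (0%R, true, 0%R).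
Definition model_a : Gk_model k := (0%R, false, 1%R).

Lemma model_rhoX n : model_rho ^+ n = (n%:R%R, false, 0%R).
Proof.
elim: n => [|n IHn] //; rewrite expgS IHn.
by rewrite [LHS]/(Gk_mul _ _) /Gk_mul /= GRing.add0r GRing.mulrS.
Qed.

Lemma model_aX n : model_a ^+ n = (0%R, false, n%:R%R).
Proof.
elim: n => [|n IHn] //; rewrite expgS IHn.
by rewrite [LHS]/(Gk_mul _ _) /Gk_mul /= GRing.add0r GRing.mulrS.
Qed.

Lemma model_decomp (u : Gk_model k) :
  u = model_rho ^+ u.1.1 * model_tau ^+ u.1.2 * model_a ^+ u.2.
Proof.
case: u => [[i b] j]; rewrite model_rhoX model_aX /=.
have -> : model_tau ^+ b = (0%R, b, 0%R) by case: b.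
rewrite [RHS]/(Gk_mul (Gk_mul _ _) _) /Gk_mul /= addbF.
by rewrite !natr_Zp /sgn; case: b; rewrite /= ?GRing.oppr0 !GRing.addr0 GRing.add0r.
Qed.

Lemma Gk_presentation_model :
  1 < k -> Gk_presentation k model_rho model_tau model_a.
Proof.
move=> k1; split.
- split; [split | | |]; rewrite ?model_rhoX ?model_aX ?pchar_Zp //.
  + by apply/eqP; rewrite eqE /= /Gk_mul /= /sgn ?GRing.oppr0 ?GRing.addr0.
  + by rewrite /commute !/(_ * _) /= /Gk_mul /= !GRing.addr0 !GRing.add0r.
  + rewrite /commute !/(_ * _) /= /Gk_mul /= /sgn ?GRing.oppr0.
    by rewrite !GRing.addr0 !GRing.add0r.
  + rewrite !/(_ * _) /= /Gk_mul /= /sgn ?GRing.oppr0.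
    by rewrite !GRing.addr0 !GRing.add0r.
- apply/eqP; rewrite eqEsubset subsetT /=; apply/subsetP=> u _.
  rewrite (model_decomp u) !groupM // groupX // mem_gen //.
  + by rewrite !inE eqxx.
  + by rewrite !inE eqxx ?orbT.
  + by rewrite !inE eqxx ?orbT.
- move=> hT x y z [[xk y2 zk] czx czy yx].
  have modX (g : hT) m : g ^+ k = 1 -> g ^+ (m %% k) = g ^+ m.
    move=> gk; rewrite [in RHS](divn_eq m k) expgD mulnC expgM gk.
    by rewrite expg1n mul1g.
  have ZD (g : hT) (i j : 'Z_k) : g ^+ k = 1 -> g ^+ (i + j)%R = g ^+ i * g ^+ j.
    move=> gk; rewrite -expgD -[RHS]modX //=.
    by congr (_ ^+ (_ %% _)); exact: Zp_cast.
  have ZN (g : hT) (i : 'Z_k) : g ^+ k = 1 -> g ^+ (- i)%R = g ^- i.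
    by move=> gk; apply/(mulIg (g ^+ i)); rewrite -ZD // GRing.addNr mulVg.
  have yX m : y * x ^+ m = x ^- m * y.
    elim: m => [|m IHm]; first by rewrite !expg0 invg1 mulg1 mul1g.
    by rewrite expgSr mulgA IHm -mulgA yx mulgA -invMg -expgS expgSr.
  have ysgn (b : bool) (i : 'Z_k) : y ^+ b * x ^+ i = x ^+ sgn b i * y ^+ b.
    by case: b; rewrite /sgn /= ?mulg1 ?mul1g // !expg1 ZN // yX.
  have yD (b c : bool) : y ^+ (b (+) c) = y ^+ b * y ^+ c.
    by case: b c => [] []; rewrite /= ?expg0 ?mulg1 ?mul1g // -expg2 y2.
  have czX j m : commute (z ^+ j) (x ^+ m) by exact: commuteX2.
  have czY j m : commute (z ^+ j) (y ^+ m) by exact: commuteX2.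
  exists (fun u => x ^+ u.1.1 * y ^+ u.1.2 * z ^+ u.2); split.
    move=> [[i b] j] [[i' b'] j'].
    rewrite /= !(ZD x) // !(ZD z) // yD.
    rewrite !mulgA -(mulgA _ (z ^+ j) (x ^+ _)) czX mulgA.
    rewrite -(mulgA _ (z ^+ j) (y ^+ _)) czY !mulgA.
    by rewrite -(mulgA _ (y ^+ b) (x ^+ _)) ysgn !mulgA.
  have one1 (g : hT) : g ^+ (1%R : 'Z_k) = g by rewrite /= expg1.
  by rewrite /= !one1 !expg0 ?expg1 !mulg1 ?mul1g.
Qed.

End Model.

(* Main.v *)
(* Put (i, b, j) = rho^i tau^b a^j and i = A + B, j = B - A, which is possible
   since k is odd. In the coordinates (A, B, b) the graph becomes the following:
   in layer b = false the rows A = const are cliques, in layer b = true the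
   columns B = const are cliques, and (A, B, false) is adjacent to
   (A', B', true) iff A + B = A' + B' with A <> A', or
   (A', B') is (A + 1, B) or (A, B + 1). Exchanging the layers by
   (A, B) |-> (-B, -A) is an automorphism.

   Counting guards row by row shows that a dominating set of size at most k has
   exactly k guards, all in one layer, say {(A, g A, false)}. Write
   h A = A + g A. If h missed a value c, then the fibre of c - 1 would have more
   than k / 2 elements and the fibre of c + 1 at least two, which is too many;
   so h is bijective, and domination then forces g to be constant. The guards of
   {(A, s, false)} cannot all move to {(d, B, true)}, because those at
   A = d and A = d + 1 are both forced to go to (d, s + 1, true); hence k guards
   are not enough. With k + 1 guards, keep one guard (A, B, true) and the others
   at all (A', B, false), or the mirror image of this configuration. *)

Require Import Defs.
From mathcomp Require Import all_boot all_fingroup all_algebra ring zify.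

Set Implicit Arguments.
Unset Strict Implicit.
Unset Printing Implicit Defensive.

(** * Invariance of both domination numbers under graph isomorphism *)

Section GraphIsomorphism.

Variables (T T' : finType) (e : rel T) (e' : rel T').
Variables (f : T -> T') (g : T' -> T).
Hypotheses (fK : cancel f g) (gK : cancel g f).
Hypothesis fe : forall u w, e' (f u) (f w) = e u w.

Let f_inj := can_inj fK.

Lemma dominating_iso D : dominating e D -> dominating e' (f @: D).
Proof.
move=> /forallP dD; apply/forallP=> w.
have /exists_inP[u uD] := dD (g w).
rewrite /dominates -fe gK -(inj_eq f_inj) gK => uw.
by apply/exists_inP; exists (f u); rewrite ?imset_f.
Qed.

Lemma reconfigures_iso D D' :
  reconfigures e D D' -> reconfigures e' (f @: D) (f @: D').
Proof.
case/existsP=> h /and3P[/eqP <- /dinjectiveP h_inj /forall_inP hD].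
apply/existsP; exists [ffun u => f (h (g u))]; apply/and3P; split.
- rewrite -!imset_comp; apply/eqP/eq_imset=> u /=.
  by rewrite ffunE fK.
- apply/dinjectiveP=> _ _ /imsetP[u uD ->] /imsetP[w wD ->].
  by rewrite !ffunE !fK => /f_inj/h_inj->.
- apply/forall_inP=> _ /imsetP[u uD ->].
  by rewrite ffunE fK fe (inj_eq f_inj) hD.
Qed.

Lemma eternal_dominating_iso D :
  eternal_dominating e D -> eternal_dominating e' (f @: D).
Proof.
case/existsP=> DD /andP[/and3P[_ /forall_inP eqDD /forall_inP stepDD] DDD].
have fDDD : f @: D \in [set f @: X | X : {set T} in DD] by exact: imset_f.
apply/existsP; exists [set f @: X | X : {set T} in DD]; rewrite fDDD andbT.
apply/and3P; split.
- by apply/set0Pn; exists (f @: D).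
- apply/forall_inP=> _ /imsetP[X XDD ->].
  apply/forall_inP=> _ /imsetP[Y YDD ->].
  by rewrite !card_imset //; move/forall_inP: (eqDD X XDD) => ->.
- apply/forall_inP=> _ /imsetP[X XDD ->]; apply/forall_inP=> w.
  rewrite -{1}[w]gK mem_imset // => wX.
  have /forall_inP/(_ _ wX)/exists_inP[Y YDD /andP[wY XY]] := stepDD X XDD.
  apply/exists_inP; exists (f @: Y); first exact: imset_f.
  by rewrite reconfigures_iso // -[w]gK imset_f.
Qed.

Lemma domination_number_iso_le :
  domination_number e' <= domination_number e.
Proof.
rewrite {2}/domination_number.
case: arg_minnP => [|D dD _]; first exact: dominating_setT.
rewrite /domination_number; case: arg_minnP => [|D' _ minD'].
  exact: dominating_setT.
by rewrite -(card_imset D f_inj) minD' ?dominating_iso.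
Qed.

Lemma eternal_domination_number_iso_le :
  eternal_domination_number e' <= eternal_domination_number e.
Proof.
rewrite {2}/eternal_domination_number.
case: arg_minnP => [|D dD _]; first exact: eternal_dominating_setT.
rewrite /eternal_domination_number; case: arg_minnP => [|D' _ minD'].
  exact: eternal_dominating_setT.
by rewrite -(card_imset D f_inj) minD' ?eternal_dominating_iso.
Qed.

End GraphIsomorphism.

Section GraphIsomorphismNumbers.

Variables (T T' : finType) (e : rel T) (e' : rel T') (f : T -> T').
Hypotheses (f_bij : bijective f) (fe : forall u w, e' (f u) (f w) = e u w).

Lemma domination_number_iso : domination_number e' = domination_number e.
Proof.
have [g fK gK] := f_bij; apply/eqP; rewrite eqn_leq.
rewrite (domination_number_iso_le fK gK fe) (domination_number_iso_le gK fK) //.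
by move=> u w; rewrite -fe !gK.
Qed.

Lemma eternal_domination_number_iso :
  eternal_domination_number e' = eternal_domination_number e.
Proof.
have [g fK gK] := f_bij; apply/eqP; rewrite eqn_leq.
rewrite (eternal_domination_number_iso_le fK gK fe).
rewrite (eternal_domination_number_iso_le gK fK) //.
by move=> u w; rewrite -fe !gK.
Qed.

End GraphIsomorphismNumbers.

(** * Criteria for the two domination numbers and for reconfiguration *)

Section DominationBasics.

Variables (T : finType) (e : rel T).
Implicit Types D : {set T}.

Lemma domination_numberP n D :
    dominating e D -> #|D| = n ->
    (forall D', dominating e D' -> n <= #|D'|) ->
  domination_number e = n.
Proof.
move=> dD <- minD; rewrite /domination_number.
case: arg_minnP => [|D' dD' minD']; first exact: dominating_setT.
by apply/eqP; rewrite eqn_leq minD' ?minD.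
Qed.

Lemma eternal_domination_numberP n D :
    eternal_dominating e D -> #|D| = n ->
    (forall D', eternal_dominating e D' -> n <= #|D'|) ->
  eternal_domination_number e = n.
Proof.
move=> dD <- minD; rewrite /eternal_domination_number.
case: arg_minnP => [|D' dD' minD']; first exact: eternal_dominating_setT.
by apply/eqP; rewrite eqn_leq minD' ?minD.
Qed.

(** An unguarded vertex can be occupied in one move, so it is dominated by the starting place of the
    guard that arrives there. *)
Lemma eternal_config_dominating DD D :
  eternal_config e DD -> D \in DD -> dominating e D.
Proof.
case/and3P=> _ _ /forall_inP stepDD DDD; apply/forallP=> w; apply/exists_inP.
have [wD | wD] := boolP (w \in D); first by exists w; rewrite ?/dominates ?eqxx.
have /forall_inP/(_ _ wD)/exists_inP[D' _ /andP[wD']] := stepDD D DDD.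
case/existsP=> h /and3P[/eqP hD _ /forall_inP hstep].
move: wD'; rewrite -hD => /imsetP[u uD wE]; exists u => //.
by rewrite /dominates wE hstep.
Qed.

(** Between sets of equal size, a map that covers the target is a bijection; for explicit moves only
    coverage then has to be checked. *)
Lemma reconfigures_onto (h : T -> T) D D' :
    #|D| = #|D'| -> {in D, forall d, dominates e d (h d)} ->
    D' \subset h @: D ->
  reconfigures e D D'.
Proof.
move=> cardD hstep subD'; have hD : h @: D = D'.
  by apply/esym/eqP; rewrite eqEcard subD' -cardD leq_imset_card.
apply/existsP; exists (finfun h).
have fE : finfun h =1 h by exact: ffunE.
rewrite (eq_imset _ fE) hD eqxx /=; apply/andP; split.
  have /imset_injP h_inj : #|h @: D| == #|D| by rewrite hD cardD.
  by apply/dinjectiveP=> u w uD wD; rewrite !fE; apply: h_inj.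
by apply/forall_inP=> d dD; rewrite fE; apply: hstep.
Qed.

End DominationBasics.

(** * The graph in coordinates and the symmetry exchanging its layers *)

Section Rook.

Import GRing.Theory.
Local Open Scope ring_scope.

Variable k : nat.

Definition position : finType := ('Z_k * 'Z_k * bool)%type.

Definition cross (A B A' B' : 'Z_k) : bool :=
  [|| (A + B == A' + B') && (A != A'), (A' == A + 1) && (B' == B)
    | (A' == A) && (B' == B + 1)].

Definition rook (u w : position) : bool :=
  let: (A, B, b) := u in let: (A', B', b') := w in
  match b, b' with
  | false, false => (A == A') && (B != B')
  | true, true => (B == B') && (A != A')
  | false, true => cross A B A' B'
  | true, false => cross A' B' A B
  end.

Implicit Types (A B s : 'Z_k) (D : {set position}) (u w : position).

Lemma dominates_ff A B A' B' :
  dominates rook (A, B, false) (A', B', false) = (A == A').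
Proof.
rewrite /dominates /= !xpair_eqE eqxx andbT [A' == A]eq_sym [B' == B]eq_sym.
by case: eqP; case: eqP.
Qed.

Lemma dominates_tt A B A' B' :
  dominates rook (A, B, true) (A', B', true) = (B == B').
Proof.
rewrite /dominates /= !xpair_eqE eqxx andbT [A' == A]eq_sym [B' == B]eq_sym.
by case: eqP; case: eqP.
Qed.

Lemma dominates_ft A B A' B' :
  dominates rook (A, B, false) (A', B', true) = cross A B A' B'.
Proof. by rewrite /dominates /= !xpair_eqE andbF. Qed.

Lemma dominates_tf A B A' B' :
  dominates rook (A, B, true) (A', B', false) = cross A' B' A B.
Proof. by rewrite /dominates /= !xpair_eqE andbF. Qed.

Definition dominatesE :=
  (dominates_ff, dominates_tt, dominates_ft, dominates_tf).

Definition swap u : position := let: (A, B, b) := u in (- B, - A, ~~ b).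

Lemma swapK : involutive swap.
Proof. by case=> [[A B] b]; rewrite /swap !opprK negbK. Qed.

Lemma cross_swap A B A' B' : cross (- B') (- A') (- B) (- A) = cross A B A' B'.
Proof.
have sumE : (- B' + - A' == - B + - A) = (A + B == A' + B').
  by rewrite -!opprD eqr_opp eq_sym [B + A]addrC [B' + A']addrC.
have nextE (x y : 'Z_k) : (- x == - y + 1) = (y == x + 1).
  apply/eqP/eqP=> [xE | ->]; last by ring.
  by rewrite -[x]opprK xE; ring.
(* When the sums agree, [A' != A] amounts to [B' != B], so the first clause of [cross] survives the
   exchange of coordinates. *)
have sum_neq : A + B = A' + B' -> (A' == A) = (B' == B).
  move=> sE; apply/eqP/eqP=> E; first by apply: (addrI A); rewrite sE E.
  by apply: (addIr B); rewrite sE E.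
rewrite /cross sumE !nextE !eqr_opp (eq_sym B B') (eq_sym A A').
rewrite [(A' == A + 1) && _]andbC [(A' == A) && _]andbC.
rewrite [X in _ = _ || X]orbC; congr (_ || _).
by case: eqP => // /sum_neq ->.
Qed.

Lemma rook_swap u w : rook (swap u) (swap w) = rook u w.
Proof.
case: u w => [[A B] []] [[A' B'] []]; rewrite /= ?cross_swap //.
all: by rewrite !(inj_eq oppr_inj).
Qed.

Hypotheses (k_gt1 : (1 < k)%N) (k_odd : odd k).

Lemma card_Zk : #|'Z_k| = k.
Proof. by rewrite card_ord Zp_cast. Qed.

(** Since [k] is odd, 2 is invertible modulo [k]; the change of coordinates rests on this as
    well. *)
Lemma addrr_inj : injective (fun x : 'Z_k => x + x).
Proof.
move=> x y /= xy; have u2 : (2%:R : 'Z_k) \is a GRing.unit.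
  by rewrite unitZpE // coprime_sym coprime2n.
by apply: (mulrI u2); rewrite !mulr_natl !mulr2n.
Qed.

(** * Counting guards row by row *)

Definition layer D (b : bool) := [set u in D | u.2 == b].

Definition free_rows D := ~: [set u.1.1 | u in layer D false].

(* A guard of layer [true] dominates one vertex of each row of layer [false],
   or two if it stands in the next row. *)
Lemma free_row_count D A :
    dominating rook D -> A \in free_rows D ->
  (k <= #|layer D true| + #|[set u in layer D true | u.1.1 == (A + 1)%R]|)%N.
Proof.
move=> /forallP dD freeA; rewrite -[leqLHS]card_Zk -cardsT.
(* [p u] is the column in which [u] dominates a vertex of row [A] wherever it stands; [q u] is the
   additional column when [u] stands in row [A + 1]. *)
pose p u : 'Z_k := if u.1.1 == A then u.1.2 - 1 else u.1.1 + u.1.2 - A.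
pose q u : 'Z_k := u.1.2.
apply: leq_trans (leq_add (leq_imset_card p _) (leq_imset_card q _)).
apply: leq_trans (leq_card_setU _ _); apply/subset_leq_card/subsetP=> B _.
have /exists_inP[[[A' B'] []] uD] := dD (A, B, false); last first.
  rewrite dominatesE => /eqP AE; move: freeA; rewrite inE => /imsetP[].
  by exists (A', B', false); rewrite ?inE ?uD.
have uDt : (A', B', true) \in layer D true by rewrite inE uD.
rewrite dominatesE => /or3P[/andP[/eqP sumE neqA]|/andP[/eqP AE /eqP BE]
  |/andP[/eqP AE /eqP BE]]; apply/setUP.
- left; apply/imsetP; exists (A', B', true) => //.
  by rewrite /p /= eq_sym (negPf neqA) -sumE addrAC subrr add0r.
- right; apply/imsetP; exists (A', B', true); last by rewrite BE.
  by rewrite inE uDt /= AE.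
- left; apply/imsetP; exists (A', B', true) => //.
  by rewrite /p /= AE eqxx BE addrK.
Qed.

(** The bound for one free row is summed over all of them. A guard of layer [true] stands in row
    [A + 1] for only one [A], so the additional terms sum to at most the number of these guards. *)
Lemma free_rows_count D : dominating rook D ->
  (#|free_rows D| * k <= #|free_rows D| * #|layer D true| + #|layer D true|)%N.
Proof.
move=> dD; set U := free_rows D; set Y := layer D true.
have le_sum : (\sum_(A in U) k
    <= \sum_(A in U) (#|Y| + #|[set u in Y | u.1.1 == (A + 1)%R]|))%N.
  by apply: leq_sum => A; apply: free_row_count.
move: le_sum; rewrite big_split /= !sum_nat_const => /leq_trans; apply.
rewrite leq_add2l; under eq_bigr => A _ do rewrite -sum1_card.
rewrite (exchange_big_dep (mem Y)) /=; last first.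
  by move=> A u _; rewrite inE => /andP[].
rewrite -[leqRHS]sum1_card; apply: leq_sum => u uY.
rewrite sum1_card -(cards1 (u.1.1 - 1)%R).
apply/subset_leq_card/subsetP=> A.
rewrite unfold_in => /andP[_]; rewrite !inE => /andP[_ /eqP->].
by rewrite addrK.
Qed.

Lemma free_rows_ge D : (k <= #|free_rows D| + #|layer D false|)%N.
Proof.
rewrite -[leqLHS]card_Zk -cardsT -(cardsID (free_rows D) setT) setTI setTD.
by rewrite leq_add2l setCK leq_imset_card.
Qed.

Lemma layer_swap D b : layer (swap @: D) b = swap @: layer D (~~ b).
Proof.
apply/setP=> u; rewrite -[u]swapK inE !(mem_imset _ _ (can_inj swapK)) inE.
by case: (swap u) => [[A B] c]; case: b c => [] [].
Qed.

Lemma dominating_swap D : dominating rook D -> dominating rook (swap @: D).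
Proof. exact: dominating_iso swapK swapK rook_swap _. Qed.

Lemma card_layers D : (#|layer D false| + #|layer D true|)%N = #|D|.
Proof.
rewrite -(cardsID [set u | u.2] D) addnC; congr addn; apply: eq_card => u.
  by rewrite !inE eqb_id.
by rewrite !inE andbC eqbF_neg.
Qed.

(** Let x and y be the numbers of guards in layers [false] and [true]. At least k - x rows are free,
    so (k - x)(k - y) <= y, and by symmetry (k - x)(k - y) <= x. If x and y are positive, then x + y
    <= k forces x = y = 1 and k = 2, against oddness. If x = 0, then k(k - y) <= y gives y = k;
    likewise for y = 0. *)
Lemma dominating_one_layer D : dominating rook D -> (#|D| <= k)%N ->
  exists b, #|layer D b| = k /\ #|layer D (~~ b)| = 0%N.
Proof.
move=> dD; rewrite -card_layers.
have k_neq2 : k != 2%N by apply: contraTneq k_odd => ->.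
have /free_rows_count := dominating_swap dD; rewrite layer_swap.
have := free_rows_count dD; have := free_rows_ge D.
have := free_rows_ge (swap @: D).
rewrite layer_swap !card_imset; try exact: can_inj swapK.
move: #|free_rows D| #|free_rows _| => m n /=.
move xE: #|layer D false| => x; move yE: #|layer D true| => y.
move=> n_ge m_ge m_le n_le xy_le.
have [x0|x_gt0] := posnP x.
  exists true; rewrite xE yE x0; split=> //; nia.
have [y0|y_gt0] := posnP y.
  exists false; rewrite xE yE y0; split=> //; nia.
nia.
Qed.

Lemma oner_neqN1 : 1 != -1 :> 'Z_k.
Proof.
apply/eqP=> E; have /eqP := oner_neq0 'Z_k; apply; apply: addrr_inj.
by rewrite {1}E addNr addr0.
Qed.

Lemma addr1_neq (c : 'Z_k) : (c + 1 == c) = false.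
Proof. by rewrite -subr_eq0 addrAC subrr add0r oner_eq0. Qed.

Lemma subr1_neq (c : 'Z_k) : (c - 1 == c) = false.
Proof. by rewrite subr_eq eq_sym addr1_neq. Qed.

Lemma shift_neq (A B B' : 'Z_k) : B != B' -> A + B - B' != A.
Proof.
by apply: contra_neq => E; apply: (addrI A); rewrite -[in RHS]E subrK.
Qed.

(** * Dominating sets with exactly one guard in each row of one layer *)

Section RowsOfGuards.

Variable g : 'Z_k -> 'Z_k.
Hypothesis dg : dominating rook [set (A, g A, false) | A : 'Z_k].

Let h A : 'Z_k := A + g A.
Let fiber (c : 'Z_k) := [set A | h A == c].

(** This is what domination of the vertex of row [A'] with coordinate sum [c] in layer [true] means
    for the sums [h]. *)
Lemma rows_cover c A' :
  (exists2 A, A != A' & h A = c) \/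
  (exists2 A, A == A' \/ A' == A + 1 & h A = c - 1).
Proof.
have /forallP/(_ (A', c - A', true))/exists_inP[_ /imsetP[A _ ->]] := dg.
rewrite dominatesE => /or3P[] /andP[/eqP E1 E2].
- by left; exists A => //; rewrite /h E1; ring.
- right; exists A; first by right; apply/eqP.
  by move/eqP: E2; rewrite /h E1 => <-; ring.
- right; exists A; first by left; apply/eqP.
  by move/eqP: E2; rewrite /h E1 => E2; rewrite -[g A](addrK 1) -E2; ring.
Qed.

(** Without the sum [c], every row lies in the fibre of [c - 1] or in its shift by 1; oddness makes
    the resulting inequality strict. If the fibre of [c + 1] were a single row [A], the vertex of
    row [A] with sum [c + 1] in layer [true] would not be dominated. *)
Lemma empty_fiber c : fiber c = set0 ->
  (k < #|fiber (c - 1)%R| + #|fiber (c - 1)%R|)%N /\ #|fiber (c + 1)%R| != 1%N.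
Proof.
move=> f0; have no A : h A <> c.
  by move=> hA; have := in_set0 A; rewrite -f0 inE hA eqxx.
split.
  have k_le : (k <= #|fiber (c - 1)%R| + #|fiber (c - 1)%R|)%N.
    rewrite -[leqLHS]card_Zk -cardsT.
    rewrite -{2}(card_imset (fiber (c - 1)) (addIr 1)).
    apply: leq_trans (leq_card_setU _ _); apply/subset_leq_card/subsetP=> A' _.
    have [[A _ /no]|[A AA' hA]] := rows_cover c A'; first by [].
    have Af : A \in fiber (c - 1) by rewrite inE hA.
    rewrite inE; case: AA' => /eqP E; first by rewrite -E Af.
    by rewrite E; apply/orP; right; apply/imsetP; exists A.
  rewrite ltn_neqAle k_le andbT; apply: contraTneq k_odd => ->.
  by rewrite addnn odd_double.
apply/negP=> /cards1P[A fA].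
have hA A1 : h A1 = c + 1 -> A1 = A.
  by move=> hA1; apply/set1P; rewrite -fA inE hA1.
have [[A1 /eqP neq /hA]|[A1 _]] := rows_cover (c + 1) A; first by [].
by rewrite addrK => /no.
Qed.

Lemma sum_fibers : (\sum_c #|fiber c| = k)%N.
Proof.
rewrite -[RHS]card_Zk -cardsT -[RHS]sum1_card [RHS](partition_big h predT) //=.
by apply: eq_bigr => c _; rewrite -sum1_card; apply: eq_bigl => A; rewrite !inE.
Qed.

Lemma fibers_nonempty c : (0 < #|fiber c|)%N.
Proof.
rewrite card_gt0; apply/eqP=> f0; have [k_lt neq1] := empty_fiber f0.
have neqN1 := oner_neqN1.
(* Two empty fibres would yield two disjoint fibres, each with more than k / 2 elements. *)
have other d : d != c -> (0 < #|fiber d|)%N.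
  move=> dc; rewrite card_gt0; apply/eqP=> d0; have [k_lt2 _] := empty_fiber d0.
  have disj : fiber (c - 1) :&: fiber (d - 1) = set0.
    apply/setP=> A; rewrite !inE; case: eqP => //= ->.
    by rewrite (inj_eq (addIr _)) eq_sym; apply: negbTE.
  have := cardsUI (fiber (c - 1)) (fiber (d - 1)).
  have := max_card (fiber (c - 1) :|: fiber (d - 1)).
  rewrite card_Zk disj cards0; lia.
(* The fibres of [c - 1] and [c + 1] have at least two elements and only that of [c] is empty.
   Summed over [d], this reads k + 2 <= k + 1. *)
have bound d : (1 + (d == c - 1)%R + (d == c + 1)%R <= #|fiber d| + (d == c))%N.
  have [->|dc] := eqVneq d c.
    by rewrite [c == c - 1]eq_sym subr1_neq [c == c + 1]eq_sym addr1_neq addn1.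
  have := other d dc.
  have [dE|_] := eqVneq d (c - 1); have [dE'|_] := eqVneq d (c + 1);
    rewrite ?dE ?dE'.
  - by case/eqP: neqN1; apply: (addrI c); rewrite -dE' dE.
  - lia.
  - by move: neq1; lia.
  - lia.
have : (\sum_d (1 + (d == (c - 1)%R) + (d == (c + 1)%R))
    <= \sum_d (#|fiber d| + (d == c)))%N.
  by apply: leq_sum => d _.
have sum1 (x : 'Z_k) : (\sum_d (d == x :> 'Z_k) = 1)%N.
  by rewrite (bigD1 x) //= eqxx big1 // => d /negPf ->.
by rewrite !big_split /= sum_fibers !sum1 sum1_card card_Zk; lia.
Qed.

Lemma rows_const A : g A = g 0.
Proof.
have h_surj c : exists A, h A = c.
  by have /card_gt0P[A1] := fibers_nonempty c; rewrite inE => /eqP; exists A1.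
have h_inj : injective h.
  suff /imset_injP h_inj : #|h @: setT| == #|[set: 'Z_k]|.
    by move=> x y; apply: h_inj.
  apply/eqP/eq_card=> c; rewrite inE; have [A1 <-] := h_surj c.
  by rewrite imset_f ?inE.
(* For the sum [h A1] in row [A1], injectivity of [h] rules out the first alternative. The guard of
   sum [h A1 - 1] cannot be the one in row [A1], so it is in row [A1 - 1]. *)
have step A1 : g (A1 - 1) = g A1.
  have [[A2 /eqP neq /h_inj]|[A2 A2E hA2]] := rows_cover (h A1) A1; first by [].
  case: A2E => /eqP A2E.
    by move: hA2; rewrite A2E => /eqP; rewrite eq_sym subr1_neq.
  move: hA2; rewrite A2E addrK /h.
  by move=> E; apply: (addrI A2); rewrite E; ring.
rewrite -(natr_Zp A); elim: (A : nat) => [|n IHn] //.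
by rewrite -IHn -step mulrSr addrK.
Qed.

End RowsOfGuards.

(** * Dominating sets of size [k], and why [k] guards are not enough *)

Definition all_rows s : {set position} := [set (A, s, false) | A : 'Z_k].

Lemma mem_all_rows s A B b : ((A, B, b) \in all_rows s) = ~~ b && (B == s).
Proof.
apply/imsetP/andP=> [[A' _ [_ -> ->]]//|[]].
by case: b => // _ /eqP ->; exists A.
Qed.

Lemma card_all_rows s : #|all_rows s| = k.
Proof. by rewrite card_imset ?card_Zk // => A A' []. Qed.

(** A vertex of layer [true] in column [s] is dominated from the preceding row, any other one by the
    guard with the same coordinate sum. *)
Lemma dominating_all_rows s : dominating rook (all_rows s).
Proof.
apply/forallP=> [[[A B] b]]; apply/exists_inP; case: b.
  have [<-|sB] := eqVneq s B.
    exists (A - 1, s, false); first by rewrite mem_all_rows eqxx.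
    by rewrite dominatesE /cross subrK !eqxx orbT.
  exists (A + B - s, s, false); first by rewrite mem_all_rows eqxx.
  rewrite dominatesE /cross subrK eqxx /=; apply/or3P; apply: Or31.
  by rewrite shift_neq // eq_sym.
by exists (A, s, false); rewrite ?mem_all_rows ?dominatesE eqxx.
Qed.

Lemma dominating_layer_false D u : dominating rook D -> (#|D| <= k)%N ->
  u \in D -> ~~ u.2 -> exists s, D = all_rows s.
Proof.
move=> dD Dk uD u0; have [b [_ b0]] := dominating_one_layer dD Dk.
have {b0} lay1 : #|layer D true| = 0%N.
  case: b b0 => //= /eqP; rewrite cards_eq0 => /eqP E.
  by have := in_set0 u; rewrite -E inE uD (negPf u0).
(* With no guard in layer [true], the counting inequality leaves no free row. *)
have /eqP free0 : free_rows D == set0.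
  have := free_rows_count dD; rewrite lay1 muln0 leqn0 muln_eq0 cards_eq0.
  by case: eqP => // _ /=; case: (k) k_gt1.
(* As no row is free, the search for a guard always succeeds. *)
pose g A := odflt 0 [pick B | (A, B, false) \in D].
have gD A : (A, g A, false) \in D.
  rewrite /g; case: pickP => //= noB.
  have := in_set0 A; rewrite -free0 inE => /negbFE/imsetP[[[A' B'] b']].
  rewrite inE => /andP[AD /eqP /= b'E] /= AE.
  by have := noB B'; rewrite /= -[false in LHS]b'E AE AD.
have DE : [set (A, g A, false) | A : 'Z_k] = D.
  apply/eqP; rewrite eqEcard card_imset; last by move=> A A' [].
  rewrite card_Zk Dk andbT; apply/subsetP=> _ /imsetP[A _ ->]; exact: gD.
exists (g 0); rewrite -DE; apply: eq_imset => A.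
by rewrite (rows_const _ A) // DE.
Qed.

Lemma eternal_config_card DD D :
  eternal_config rook DD -> D \in DD -> (k < #|D|)%N.
Proof.
move=> cDD DDD; rewrite ltnNge; apply/negP=> Dk.
have /and3P[_ /forall_inP/(_ _ DDD)/forall_inP eqDD /forall_inP stepDD] := cDD.
have leDD X : X \in DD -> (#|X| <= k)%N by move=> /eqDD/eqP <-.
have dDD := eternal_config_dominating cDD.
have [D1 D1DD D1u] : exists2 D1, D1 \in DD & (0, 0, false) \in D1.
  have [uD|uD] := boolP ((0, 0, false) \in D); first by exists D.
  have /forall_inP/(_ _ uD)/exists_inP[D1 D1DD /andP[D1u _]] := stepDD D DDD.
  by exists D1.
have [s D1E] := dominating_layer_false (dDD _ D1DD) (leDD _ D1DD) D1u isT.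
(* All guards are now in layer [false]; an attack in the other layer makes every one of them change
   layers at once. *)
have wD1 : (0, 0, true) \notin D1 by rewrite D1E mem_all_rows.
have /forall_inP/(_ _ wD1)/exists_inP[D2 D2DD /andP[D2w]] := stepDD D1 D1DD.
have [t D2E] : exists t, swap @: D2 = all_rows t.
  apply: (dominating_layer_false _ _ (imset_f swap D2w)) => //.
    exact: dominating_swap (dDD _ D2DD).
  by rewrite card_imset ?leDD //; apply: can_inj swapK.
case/existsP=> h /and3P[/eqP hD /dinjectiveP h_inj /forall_inP hstep].
(* [D2] is the row [- t] of layer [true]. The guard in row [- t] can enter it only by the step from
   [s] to [s + 1], the guard in row [- t + 1] only by keeping its coordinate sum; both land on the
   same vertex. *)
have forced A : A == - t \/ A == - t + 1 ->
    h (A, s, false) = (- t, s + 1, true).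
  move=> AE; have AD1 : (A, s, false) \in D1 by rewrite D1E mem_all_rows eqxx.
  have : dominates rook (A, s, false) (h (A, s, false)) by exact: hstep.
  have : h (A, s, false) \in D2 by rewrite -hD imset_f.
  rewrite -(mem_imset _ _ (can_inj swapK)) D2E.
  case: (h _) => [[A' B'] b']; rewrite mem_all_rows negbK => /andP[b't].
  rewrite b't dominatesE eqr_oppLR => /eqP -> .
  case/or3P=> /andP[/eqP E1 /eqP E2].
  - case: AE => /eqP AE; first by case: E2.
    congr (_, _, _); apply: (addrI (- t)); rewrite -E1 AE; ring.
  - case: AE => /eqP AE; move: E1; rewrite AE => /esym/eqP.
      by rewrite addr1_neq.
    by rewrite -addrA -subr_eq0 addrAC subrr add0r addr_eq0 (negPf oner_neqN1).
  - by rewrite E2.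
have := h_inj (- t, s, false) (- t + 1, s, false).
rewrite !forced ?eqxx; [|by right|by left].
rewrite D1E !mem_all_rows eqxx => /(_ isT isT erefl)/eqP.
by rewrite !xpair_eqE eq_sym addr1_neq.
Qed.

(** * An eternal configuration with [k + 1] guards *)

(* u is the only guard in its layer. *)
Definition config u : {set position} :=
  u |: if u.2 then [set (A, u.1.2, false) | A : 'Z_k]
       else [set (u.1.1, B, true) | B : 'Z_k].

Lemma mem_config A B b A' B' b' :
  ((A', B', b') \in config (A, B, b)) =
    if b == b' then (A' == A) && (B' == B)
    else if b then B' == B else A' == A.
Proof.
rewrite !inE !xpair_eqE; case: b => /=.
  have -> : ((A', B', b') \in [set (A0, B, false) | A0 : 'Z_k])
      = ~~ b' && (B' == B) by exact: mem_all_rows.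
  by case: b'; rewrite ?andbT ?andbF ?orbF.
have -> : ((A', B', b') \in [set (A, B0, true) | B0 : 'Z_k])
    = b' && (A' == A).
  apply/imsetP/andP=> [[B0 _ [-> _ ->]]//|[]].
  by case: b' => // _ /eqP ->; exists B'.
by case: b'; rewrite ?andbT ?andbF ?orbF.
Qed.

Lemma config_swap u : config (swap u) = swap @: config u.
Proof.
apply/setP=> w; rewrite -[w]swapK mem_imset; last exact: can_inj swapK.
case: u (swap w) => [[A B] b] [[A' B'] b'].
rewrite /swap !mem_config !eqr_opp.
by case: b b' => [] [] //=; rewrite andbC.
Qed.

Lemma card_config u : #|config u| = k.+1.
Proof.
rewrite cardsU1; case: u => [[A B] []] /=.
  by rewrite card_all_rows mem_all_rows.
rewrite card_imset ?card_Zk; last by move=> B1 B2 [].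
by case: imsetP => // [[]].
Qed.

Lemma config_step u w : u.2 -> w \notin config u ->
  exists2 v, w \in config v & reconfigures rook (config u) (config v).
Proof.
case: u w => [[A B] b] [[A0 B0] b0] /= bT; rewrite {}bT mem_config.
case: b0 => /= [_|B0B].
  (* Attack in the layer of the lone guard: it slides along its column to row [A0], the guard
     [(A0, B, false)] stays and becomes the lone one, and the others change layers into row [A0],
     keeping their sums. *)
  exists (A0, B, false); first by rewrite mem_config /= eqxx.
  pose h u : position := if u.2 then (A0, u.1.2, true)
    else if u.1.1 == A0 then u else (A0, u.1.1 + u.1.2 - A0, true).
  apply: (reconfigures_onto (h := h)); first by rewrite !card_config.
    move=> [[A1 B1] b1] _; rewrite /h /=; case: b1; first by rewrite dominatesE.
    case: eqP => [->|/eqP A10]; first by rewrite dominatesE.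
    by rewrite dominatesE /cross [A0 + _]addrC subrK eqxx A10.
  apply/subsetP=> [[[A1 B1] b1]]; rewrite mem_config => w1; apply/imsetP.
  case: b1 w1 => /= [/eqP -> | /andP[/eqP -> /eqP ->]]; last first.
    by exists (A0, B, false); rewrite /h /= ?eqxx // mem_config /=.
  have [->|B1B] := eqVneq B1 B.
    by exists (A, B, true); rewrite ?mem_config ?eqxx.
  exists (A0 + B1 - B, B, false); first by rewrite mem_config /=.
  rewrite /h /= ifN; first by congr (_, _, _); ring.
  exact: shift_neq.
(* Attack in the other layer: the lone guard and the guard [(A1, B, false)] change layers, keeping
   their sums, while the others slide along their rows to column [B0]. [A1] is the row where the
   lone guard enters that column. *)
pose A1 := A + B - B0.
exists (A1 + B - B0, B0, true); first by rewrite mem_config /=.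
pose h u : position := if u.2 then (A1, B0, false)
  else if u.1.1 == A1 then (A1 + B - B0, B0, true) else (u.1.1, B0, false).
apply: (reconfigures_onto (h := h)); first by rewrite !card_config.
  move=> [[A2 B2] b2]; rewrite mem_config /h /=.
  case: b2 => /= [/andP[/eqP -> /eqP ->] | /eqP ->].
    by rewrite dominatesE /cross subrK eqxx shift_neq // eq_sym.
  case: eqP => [->|_]; last by rewrite dominatesE.
  by rewrite dominatesE /cross subrK eqxx eq_sym shift_neq // eq_sym.
apply/subsetP=> [[[A2 B2] b2]]; rewrite mem_config /=; case: b2 => /= w2.
  apply/imsetP; exists (A1, B, false); first by rewrite mem_config /=.
  by case/andP: w2 => /eqP -> /eqP ->; rewrite /h /= eqxx.
apply/imsetP; move/eqP: w2 => ->; have [->|A21] := eqVneq A2 A1.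
  by exists (A, B, true); rewrite ?mem_config /= ?eqxx.
exists (A2, B, false); first by rewrite mem_config /=.
by rewrite /h /= (negPf A21).
Qed.

Lemma eternal_config_all : eternal_config rook [set config u | u : position].
Proof.
apply/and3P; split.
- by apply/set0Pn; exists (config (0, 0, false)); apply: imset_f.
- apply/forall_inP=> _ /imsetP[u _ ->]; apply/forall_inP=> _ /imsetP[w _ ->].
  by rewrite !card_config.
- apply/forall_inP=> _ /imsetP[u _ ->]; apply/forall_inP=> w wu.
  apply/exists_inP; have [u1|u0] := boolP u.2.
    have [v wv uv] := config_step u1 wu.
    by exists (config v); [apply: imset_f | rewrite wv].
  (* A lone guard in layer [false] is treated through the mirror image. *)
  have swap_u1 : (swap u).2 by case: (u) u0 => [[]].
  have [|v wv uv] := config_step (w := swap w) swap_u1.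
    by rewrite config_swap mem_imset //; apply: can_inj swapK.
  exists (config (swap v)); first exact: imset_f.
  rewrite config_swap -[w]swapK imset_f //=.
  have -> : config u = swap @: config (swap u) by rewrite -config_swap swapK.
  exact: reconfigures_iso swapK rook_swap _ _ uv.
Qed.

Lemma rook_domination_number : domination_number rook = k.
Proof.
apply: (domination_numberP (dominating_all_rows 0) (card_all_rows 0)) => D dD.
rewrite leqNgt; apply/negP=> Dk.
have [b [bk b0]] := dominating_one_layer dD (ltnW Dk).
move: Dk; rewrite -card_layers.
by case: b bk b0 => /= -> ->; rewrite ?addn0 ltnn.
Qed.

Lemma rook_eternal_domination_number : eternal_domination_number rook = k.+1.
Proof.
apply: (eternal_domination_numberP _ (card_config (0, 0, false))).
  apply/existsP; exists [set config u | u : position].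
  by rewrite eternal_config_all imset_f.
move=> D /existsP[DD /andP[cDD DDD]]; exact: eternal_config_card cDD DDD.
Qed.

End Rook.

(** * Uniqueness of the presented group, and transport of the graph *)

Section Presentation.

Import GroupScope.

(** The fixed points of [h] form a subgroup containing the generators. *)
Lemma morph_gen_id (gT : finGroupType) (X : {set gT}) (h : gT -> gT) :
    <<X>> = [set: gT] -> {morph h : u v / u * v} -> {in X, forall x, h x = x} ->
  h =1 id.
Proof.
move=> genX hM hX; pose hm := Morphism (in2W hM : {in [set: gT] &, _}).
have fix_group : group_set [set x | hm x == x].
  apply/group_setP; split=> [|x y]; rewrite !inE ?morph1 //.
  by move=> /eqP xE /eqP yE; rewrite morphM ?inE // xE yE.
have: <<X>> \subset Group fix_group.
  by rewrite gen_subG; apply/subsetP=> x /hX xE; rewrite inE /= xE.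
rewrite genX => /subsetP sub x; have := sub x (in_setT x).
by rewrite inE => /eqP.
Qed.

(** The two universal properties give maps in both directions; their composites fix the generators,
    hence are identities. *)
Lemma presentation_iso (k : nat) (gT hT : finGroupType)
    (r t a : gT) (x y z : hT) :
    Gk_presentation k r t a -> Gk_presentation k x y z ->
  exists2 f : gT -> hT, bijective f &
    {morph f : u v / u * v} /\ [/\ f r = x, f t = y & f a = z].
Proof.
case=> relG genG univG [relH genH univH].
have [f [fM [fr ft fa]]] := univG _ _ _ _ relH.
have [g [gM [gx gy gz]]] := univH _ _ _ _ relG.
exists f => //; exists g.
  apply: (morph_gen_id genG) => [u v | u] /=; first by rewrite fM gM.
  by rewrite !inE -orbA => /or3P[] /eqP ->; rewrite ?(fr, ft, fa).
apply: (morph_gen_id genH) => [u v | u] /=; first by rewrite gM fM.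
by rewrite !inE -orbA => /or3P[] /eqP ->; rewrite ?(gx, gy, gz).
Qed.

Lemma Gamma_morph (k : nat) (gT hT : finGroupType) (f : gT -> hT) (r t a : gT) :
    injective f -> {morph f : u v / u * v} ->
  forall u w, Gamma k (f r) (f t) (f a) (f u) (f w) = Gamma k r t a u w.
Proof.
move=> f_inj fM u w; pose fm := Morphism (in2W fM : {in [set: gT] &, _}).
have fX x n : f (x ^+ n) = f x ^+ n by rewrite -[f]/(fm : _ -> _) morphX ?inE.
have fV x : f x^-1 = (f x)^-1 by rewrite -[f]/(fm : _ -> _) morphV ?inE.
rewrite /Gamma /cay /= !mem_lcoset -fV -fM.
suff -> : Sk k (f r) (f t) (f a) = f @: Sk k r t a by rewrite mem_imset.
rewrite /Sk !imsetU -!imset_comp !imset_set1 !fM fV.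
by congr (_ :|: _ :|: _); apply: eq_imset => i /=; rewrite fM !fX.
Qed.

End Presentation.

(** * From the concrete group to the coordinates *)

Section Coordinates.

Import GRing.Theory.
Local Open Scope ring_scope.

Variable k : nat.
Hypotheses (k_gt1 : (1 < k)%N) (k_odd : odd k).

Lemma mem_Sk_model (i j : 'Z_k) b :
  (((i, b, j) : Gk_model k) \in Sk k (model_rho k) (model_tau k) (model_a k)) =
    if b then (i == 0) && (j != 0) || (i == 1) && ((j == 1) || (j == -1))
    else (i == j) && (j != 0).
Proof.
(* The exponents strictly between 0 and [k] represent exactly the nonzero residues. *)
have nzP (x : 'Z_k) : reflect (exists2 n : 'I_k, (0 < n)%N & x = n%:R) (x != 0).
  apply: (iffP idP) => [x0 | [n n0 ->]].
    have x_lt : (x < k)%N by have := ltn_ord x; rewrite [X in (_ < X)%N]Zp_cast.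
    exists (Ordinal x_lt); last by rewrite /= natr_Zp.
    by rewrite lt0n; apply: contra_neq x0 => /= x0; apply: val_inj.
  apply/eqP=> /(congr1 val) /=; rewrite val_Zp_nat // modn_small // => n_eq0.
  by rewrite n_eq0 in n0.
have tauE n : (model_tau k * model_a k ^+ n)%g = (0, true, n%:R).
  by rewrite model_aX [LHS]/(Gk_mul _ _) /Gk_mul /= oppr0 !add0r.
have rhoE n : (model_rho k ^+ n * model_a k ^+ n)%g = (n%:R, false, n%:R).
  by rewrite model_rhoX model_aX [LHS]/(Gk_mul _ _) /Gk_mul /= addr0 add0r.
have rtE (x : 'Z_k) :
    (model_rho k * model_tau k * ((0, false, x) : Gk_model k))%g = (1, true, x).
  by rewrite [LHS]/(Gk_mul (Gk_mul _ _) _) /Gk_mul /= oppr0 !addr0 !add0r.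
have aV : (model_a k)^-1%g = (0, false, -1).
  by rewrite [LHS]/(Gk_inv _) /Gk_inv /= oppr0.
rewrite !inE aV !rtE.
have -> : ((i, b, j) \in
      [set (model_tau k * model_a k ^+ n)%g | n : 'I_k & (0 < n)%N])
    = [&& b, i == 0 & j != 0].
  apply/imsetP/and3P=> [[n]|[bT /eqP -> /nzP[n n0 ->]]].
    by rewrite inE tauE => n0 [-> -> ->]; split=> //; apply/nzP; exists n.
  by exists n; rewrite ?inE // tauE; case: b bT.
have -> : ((i, b, j) \in
      [set (model_rho k ^+ n * model_a k ^+ n)%g | n : 'I_k & (0 < n)%N])
    = [&& ~~ b, i == j & j != 0].
  apply/imsetP/and3P=> [[n]|[bF /eqP -> /nzP[n n0 ->]]].
    by rewrite inE rhoE => n0 [-> -> ->]; split=> //; apply/nzP; exists n.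
  by exists n; rewrite ?inE // rhoE; case: b bF.
rewrite !xpair_eqE; case: b => /=; rewrite ?andbT ?andbF ?orbF //.
by rewrite -andb_orr.
Qed.

Definition model_of_position (u : position k) : Gk_model k :=
  let: (A, B, b) := u in (A + B, b, B - A).

(** Sum and difference determine [B + B], hence [B] and then [A]; surjectivity follows by
    cardinality. *)
Lemma model_of_position_bij : bijective model_of_position.
Proof.
apply: inj_card_bij; last first.
  by rewrite -[leqLHS]/#|{: 'Z_k * bool * 'Z_k}| !card_prod mulnAC.
move=> [[A B] b] [[A' B'] b'] E.
have sE : A + B = A' + B' := congr1 (fun u : Gk_model k => u.1.1) E.
have dE : B - A = B' - A' := congr1 (fun u : Gk_model k => u.2) E.
have -> : b = b' := congr1 (fun u : Gk_model k => u.1.2) E.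
have BE : B = B'.
  apply: (addrr_inj k_gt1 k_odd); have -> : B + B = (A + B) + (B - A) by ring.
  by rewrite sE dE; ring.
by congr (_, _, _); first by apply: (addIr B); rewrite sE BE.
Qed.

Let double_eq0 (x : 'Z_k) : (x + x == 0) = (x == 0).
Proof. by rewrite -{1}[0](addr0 0) (inj_eq (addrr_inj k_gt1 k_odd)). Qed.

Lemma cross_diff (A B A' B' : 'Z_k) (x := A' - A) (y := B' - B) :
  cross A B A' B'
    = [|| (x + y == 0) && (x != 0), (x == 1) && (y == 0)
        | (x == 0) && (y == 1)].
Proof.
rewrite /cross /x /y !subr_eq0 [A == A']eq_sym !subr_eq ![1 + _]addrC.
congr ((_ && _) || _); rewrite eq_sym -subr_eq0; congr (_ == _); ring.
Qed.

(** The left side is membership of rho^i tau a^j in the connection set, with i = x + y and j = y -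
    x. If i = 0 then j = -2x; if i = 1, then j = 1 means x = 0 and j = -1 means y = 0. *)
Lemma diff_system (x y : 'Z_k) :
  (x + y == 0) && (y - x != 0)
      || (x + y == 1) && ((y - x == 1) || (y - x == -1))
    = [|| (x + y == 0) && (x != 0), (x == 1) && (y == 0)
        | (x == 0) && (y == 1)].
Proof.
congr (_ || _).
  case: eqP => //= xy0; rewrite -double_eq0 -[x + x == 0]oppr_eq0.
  have -> : - (x + x) = y - x - (x + y) by ring.
  by rewrite xy0 subr0.
apply/andP/orP=> [[/eqP xy1 /orP[]/eqP yx] | [] /andP[/eqP -> /eqP ->]].
- have x0 : x = 0.
    by apply/eqP; rewrite -double_eq0 -(subrr 1) -{1}xy1 -yx; apply/eqP; ring.
  by right; rewrite -xy1 x0 add0r !eqxx.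
- have y0 : y = 0.
    by apply/eqP; rewrite -double_eq0 -(subrr 1) -{1}xy1 -yx; apply/eqP; ring.
  by left; rewrite -xy1 y0 addr0 !eqxx.
- by rewrite addr0 sub0r !eqxx orbT.
- by rewrite add0r subr0 !eqxx.
Qed.

Lemma Gamma_model_position u w :
  Gamma k (model_rho k) (model_tau k) (model_a k)
    (model_of_position u) (model_of_position w) = rook u w.
Proof.
case: u w => [[A B] b] [[A' B'] b']; rewrite /Gamma /cay /= mem_lcoset.
rewrite [(_ * _)%g]/(Gk_mul (Gk_inv _) _) /Gk_mul /Gk_inv /=.
rewrite mem_Sk_model.
(* Within a layer, the condition i = j on u^-1 w says that twice a difference of columns (layer
   [true]) or of rows (layer [false]) vanishes. From layer [true] to [false] only the sign of j
   changes, which the conditions on j do not see. *)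
case: b b' => [] [] /=; rewrite ?cross_diff -?diff_system.
- rewrite -subr_eq0; have -> : - - (A + B) - (A' + B') - (- (B - A) + (B' - A'))
    = B - B' + (B - B') by ring.
  rewrite double_eq0 subr_eq0; case: eqP => //= ->.
  by rewrite -[A == A']subr_eq0; congr (_ != _); ring.
- have -> : - - (A + B) - (A' + B') = A - A' + (B - B') by ring.
  have -> : - (B - A) + (B' - A') = - (B - B' - (A - A')) by ring.
  by rewrite oppr_eq0 eqr_oppLR eqr_opp [_ || (_ == 1)]orbC.
- have -> : - (A + B) + (A' + B') = A' - A + (B' - B) by ring.
  by have -> : - (B - A) + (B' - A') = B' - B - (A' - A) by ring.
- rewrite -subr_eq0; have -> : - (A + B) + (A' + B') - (- (B - A) + (B' - A'))
    = A' - A + (A' - A) by ring.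
  rewrite double_eq0 subr_eq0 [A' == A]eq_sym; case: eqP => //= ->.
  by rewrite -[B == B']subr_eq0 -oppr_eq0; congr (_ != _); ring.
Qed.

End Coordinates.

Theorem theorem4p8 (k : nat) (gT : finGroupType) (rho tau a : gT)
    (k_gt1 : 1 < k) (k_odd : odd k)
    (pres : Gk_presentation k rho tau a) :
  eternal_domination_number (Gamma k rho tau a)
    = (domination_number (Gamma k rho tau a)).+1.
Proof.
have [f f_bij [fM [<- <- <-]]] :=
  presentation_iso (Gk_presentation_model k_gt1) pres.
have fe := Gamma_morph k (model_rho k) (model_tau k) (model_a k)
  (bij_inj f_bij) fM.
rewrite (eternal_domination_number_iso f_bij fe).
rewrite (domination_number_iso f_bij fe).
have g_bij := model_of_position_bij k_gt1 k_odd.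
have ge := Gamma_model_position k_gt1 k_odd.
rewrite (eternal_domination_number_iso g_bij ge).
rewrite (domination_number_iso g_bij ge).
by rewrite rook_eternal_domination_number // rook_domination_number.
Qed.
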